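(* Let $(Z,d,\nu)$ be a complete doubling metric measure space, $p\ge1$ and $0<\theta<1$. Suppose that $\nu$ has relative lower volume decay of order $Q>0$. Set $Q_\beta=\max\{1,Q+p(1-\theta)\}$ and assume that $p>Q_\beta$. Then every function in $\tilde B^\theta_p(Z)$ has a representative (a function agreeing with it $\nu$-a.e.) that is locally $(1-Q_\beta/p)$-Hölder continuous.
   Context: A metric measure space is a metric space with a Borel regular measure giving every ball positive finite measure; it is doubling if $\nu(B(z,2r))\le C_\nu\nu(B(z,r))$ for all $z,r$. $\nu$ has relative lower volume decay of order $Q$ if there is a constant $C_{\rm low}\ge1$ with $\frac{\nu(B(z,r'))}{\nu(B(z,r))}\ge C_{\rm low}^{-1}\left(\frac{r'}{r}\right)^Q$ for all $z\in Z$, $0<r'\le r$. $L^p_{\rm loc}(Z)$: measurable functions in $L^p(B)$ for every ball $B\subset Z$. $\|u\|_{B^\theta_p(Z)}^p=\int_Z\int_Z\frac{|u(x)-u(y)|^p}{d(x,y)^{p\theta}}\frac{d\nu(x)\,d\nu(y)}{\nu(B(x,d(x,y)))}$; $\tilde B^\theta_p(Z)=\{u\in L^p_{\rm loc}(Z):\|u\|_{B^\theta_p(Z)}<\infty\}$. ''Locally Hölder continuous'' means Hölder continuous on every ball of $Z$ (with constant depending on the ball). *)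

(* Defs.v *)
From HB Require Import structures.
From mathcomp Require Import all_boot all_order all_algebra.
From mathcomp Require Import all_classical all_reals all_analysis.

Set Implicit Arguments.
Unset Strict Implicit.
Unset Printing Implicit Defensive.

Import Order.TTheory GRing.Theory Num.Theory.
Import numFieldNormedType.Exports.

Local Open Scope classical_set_scope.
Local Open Scope ring_scope.

(* MathComp-Analysis' [completeType] is pointed, so the empty space is excluded.
   In a [metricType], [ball x r] is the open ball [set y | mdist x y < r]; in
   particular it is empty for r <= 0. *)
#[short(type="completeMetricType")]
HB.structure Definition CompleteMetric (R : numDomainType) :=
  {T of Complete T & Metric R T}.

Section metric_measure_space.
Context {R : realType} {Z : completeMetricType R}.
Variable nu : {outer_measure set Z -> \bar R}.

(* A Borel regular measure is, as usual in analysis on metric spaces, an outer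
   measure for which Borel sets are (Caratheodory) measurable and every set has
   a Borel hull. *)
Definition borel_regular : Prop :=
  (forall B : set Z, <<s @open Z >> B -> nu.-caratheodory B) /\
  (forall A : set Z, exists B : set Z,
     [/\ <<s @open Z >> B, A `<=` B & nu B = nu A]).

Definition metric_measure_space : Prop :=
  borel_regular /\
  (forall (z : Z) (r : R), 0 < r ->
     (0 < nu (ball z r))%E /\ (nu (ball z r) < +oo)%E).

Definition doubling : Prop :=
  exists C : R, forall (z : Z) (r : R), 0 < r ->
    (nu (ball z (2 * r)) <= C%:E * nu (ball z r))%E.

(* [fine] is harmless in a metric measure space: balls have finite measure. *)
Definition relative_lower_volume_decay (Q : R) : Prop :=
  exists2 Clow : R, 1 <= Clow & forall (z : Z) (r r' : R), 0 < r' -> r' <= r ->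
    fine (nu (ball z r')) / fine (nu (ball z r)) >= Clow^-1 * (r' / r) `^ Q.

(* nu as a (complete) measure on its Caratheodory sigma-algebra; measurability,
   integrals and "almost everywhere" below refer to it. *)
Definition cara_measure : {measure set (caratheodory_type nu) -> \bar R} :=
  (nu : set (caratheodory_type nu) -> \bar R).

Definition Lp_loc (p : R) (u : Z -> R) : Prop :=
  measurable_fun [set: caratheodory_type nu] (u : caratheodory_type nu -> R) /\
  (forall (z : Z) (r : R), 0 < r -> u \_ (ball z r) \in Lfun cara_measure p%:E).

(* On the diagonal the quotient reads 0 / 0, which is 0 here. *)
Definition besov_norm (theta p : R) (u : Z -> R) : \bar R :=
  ((\int[cara_measure]_y \int[cara_measure]_x
     (`|u x - u y| `^ p / mdist (x : Z) (y : Z) `^ (p * theta)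
       / fine (nu (ball (x : Z) (mdist (x : Z) (y : Z)))))%:E) `^ p^-1)%E.

Definition besov_space (theta p : R) : set (Z -> R) :=
  [set u | Lp_loc p u /\ (besov_norm theta p u < +oo)%E].

Definition representative (u v : Z -> R) : Prop :=
  {ae cara_measure, forall x, u x = v x}.

End metric_measure_space.

Definition locally_holder {R : realType} {Z : metricType R}
    (alpha : R) (v : Z -> R) : Prop :=
  forall (z : Z) (r : R), 0 < r ->
    exists C : R, forall x y : Z, ball z r x -> ball z r y ->
      `|v x - v y| <= C * mdist x y `^ alpha.

(* Main.v *)
(* The proof needs neither averages nor Lebesgue's differentiation theorem. By
   Chebyshev, every ball B(z, r) carries a constant c(z, r), a value of u, with
   nu {x in B(z, r) : |u x - c(z, r)| > t} <= K r^(p theta) / t^p. The mass of a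
   ball of radius r being at least of order r^Q locally, taking t of order r^s,
   s = theta - Q / p, makes the exceptional sets of two comparable balls too
   small to cover both, so that their constants differ by O(r^s). Hence
   c(z, r) converges to some v z at rate O(r^s) as r goes to 0, and v is locally
   s-Hoelder, while s >= 1 - Qbeta / p. Finally a bounded set is covered by
   O(r^-Q) balls of radius r, so {|u - v| > e} has measure
   O(r^(p theta - Q)) there, hence is null. *)
Require Import Defs.
From mathcomp Require Import all_boot all_order all_algebra.
From mathcomp Require Import all_classical all_reals all_analysis.
From mathcomp Require Import measurable_realfun.
From mathcomp Require Import ring lra.

Import Order.TTheory GRing.Theory Num.Theory.
Import numFieldNormedType.Exports.
Local Open Scope classical_set_scope.
Local Open Scope ring_scope.

(** * Chebyshev-type lower bound for integrals *)

Section nonneg_integral.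
Context d (T : measurableType d) (R : realType).
Variable mu : {measure set T -> \bar R}.

(* [f] need not be measurable: the integral is a supremum over simple
   functions below [f]. *)
Lemma integral_minorant (f : T -> \bar R) (a : R) (A : set T) :
  measurable A -> 0 <= a -> (forall x, 0 <= f x)%E ->
  (forall x, A x -> a%:E <= f x)%E ->
  (a%:E * mu A <= \int[mu]_x f x)%E.
Proof.
move=> mA a0 f0 af.
have -> : (a%:E * mu A = \int[mu]_x ((cst a%:E) \_ A) x)%E.
  by rewrite -integral_mkcond integral_cst.
have g0 x : (0 <= ((cst a%:E) \_ A) x)%E.
  by rewrite /patch; case: ifP => // _; rewrite lee_fin.
rewrite !ge0_integralTE//; apply: le_ereal_sup => _ [h /= hg <-].
exists h => // x; apply: le_trans (hg x) _.
by rewrite /patch; case: ifPn => //; rewrite inE => /af.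
Qed.

End nonneg_integral.

(** * Open balls in a metric space *)

Section metric_balls.
Context {R : realType} {Z : metricType R}.
Implicit Types (x y z : Z) (r : R).

Lemma metric_ballE z r x : ball z r x = (mdist z x < r) :> Prop.
Proof. by rewrite ballEmdist. Qed.

Lemma metric_ball_open z r : open (ball z r).
Proof.
rewrite openE => x; rewrite metric_ballE => zx.
apply/nbhs_ballP; exists (r - mdist z x) => /=; first by rewrite subr_gt0.
move=> y; rewrite !metric_ballE => xy.
by have := metric_triangle z x y; lra.
Qed.

Lemma metric_ball_subset x y r r' :
  mdist x y + r' <= r -> ball y r' `<=` ball x r.
Proof.
move=> h z; rewrite !metric_ballE => yz.
by have := metric_triangle x y z; lra.
Qed.

End metric_balls.

(** * Weak-type estimate on balls from finite Besov energy *)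

Section weak_type.
Context {R : realType} {Z : completeMetricType R}.
Variable nu : {outer_measure set Z -> \bar R}.
Hypothesis nuP : metric_measure_space nu.

Lemma caratheodory_ball z r : nu.-caratheodory (ball z r).
Proof.
by apply: nuP.1.1; apply: sub_sigma_algebra; exact: metric_ball_open.
Qed.

Lemma ball_mass_fin_num z r : 0 < r -> nu (ball z r) \is a fin_num.
Proof.
move=> r0; have [? ?] := nuP.2 z r r0.
by rewrite ge0_fin_numE// outer_measure_ge0.
Qed.

Lemma ball_mass_gt0 z r : 0 < r -> 0 < fine (nu (ball z r)).
Proof. by move=> r0; rewrite fine_gt0//; apply/andP; exact: nuP.2. Qed.

Lemma fine_ball_massE z r : 0 < r -> (fine (nu (ball z r)))%:E = nu (ball z r).
Proof. by move=> r0; rewrite fineK// ball_mass_fin_num. Qed.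

Lemma doubling_fine : doubling nu -> exists2 C : R, 0 < C &
  forall z r, 0 < r -> fine (nu (ball z (2 * r))) <= C * fine (nu (ball z r)).
Proof.
move=> [C hC]; exists C => [|z r r0]; last first.
  by rewrite -lee_fin EFinM !fine_ball_massE ?mulr_gt0//; exact: hC.
(* [C] is positive because the balls of radii 1 and 2 about [point] both have positive mass. *)
have := hC point 1 ltr01; rewrite mulr1.
rewrite -(@fine_ball_massE _ 2)// -(@fine_ball_massE _ 1)// -EFinM lee_fin => h.
have := ball_mass_gt0 point 2 (ltr0n _ 2); have := ball_mass_gt0 point 1 ltr01.
by move=> m1 m2; rewrite -(pmulr_lgt0 _ m1) (lt_le_trans m2).
Qed.

(* [c] is a value [u y] at a point [y] of the ball where the inner Besov
   integral is at most its average; the estimate is then Chebyshev's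
   inequality in [x]. *)
Lemma besov_weak_type (p theta : R) (u : Z -> R) :
  doubling nu -> 1 <= p -> 0 < theta -> besov_space nu theta p u ->
  exists2 K : R, 0 < K & forall z r, 0 < r -> exists c : R, forall t, 0 < t ->
    (nu [set x | ball z r x /\ (t < `|u x - c|)%R]
       <= (K * r `^ (p * theta) / t `^ p)%:E)%E.
Proof.
move=> /doubling_fine[C C0 dbl] p1 th0 [[mu_ _] bes].
have p0 : 0 < p by rewrite (lt_le_trans ltr01).
pose f (y x : Z) : R := `|u x - u y| `^ p / mdist x y `^ (p * theta)
  / fine (nu (ball x (mdist x y))).
have f0 y x : 0 <= f y x.
  by rewrite /f !divr_ge0 ?powR_ge0// fine_ge0// outer_measure_ge0.
pose G (y : Z) : \bar R := (\int[cara_measure nu]_x (f y x)%:E)%E.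
have G0 y : (0 <= G y)%E by apply: integral_ge0 => x _; rewrite lee_fin.
pose I := (\int[cara_measure nu]_y G y)%E.
have I0 : (0 <= I)%E by exact: integral_ge0.
have Ifin : I \is a fin_num.
  rewrite ge0_fin_numE// ltey; apply/eqP => Ioo.
  move: bes; rewrite /besov_norm -/I.
  rewrite [X in (X `^ _)%E]Ioo poweRyr ?invr_eq0 ?gt_eqF//.
pose J := fine I.
have JE : J%:E = I by rewrite /J fineK.
have J0 : 0 <= J by rewrite /J fine_ge0.
(* [J + 1] comes from the choice of [y], [C ^+ 2] from doubling twice, the power of 2 from distances
   below [2 * r]. *)
exists ((J + 1) * C ^+ 2 * 2 `^ (p * theta)) => [|z r r0].
  by rewrite !mulr_gt0 ?exprn_gt0 ?powR_gt0//; lra.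
set m := fine (nu (ball z r)).
have m0 : 0 < m by exact: ball_mass_gt0.
(* Otherwise [G] exceeds [(J + 1) / m] on the whole ball, and the energy [J] would be at least
   [J + 1]. *)
have [y [By Gy]] : exists y, ball z r y /\ (G y <= ((J + 1) / m)%:E)%E.
  apply: contrapT => nG.
  have : (((J + 1) / m)%:E * cara_measure nu (ball z r) <= I)%E.
    apply: integral_minorant => //; first exact: caratheodory_ball.
      by rewrite divr_ge0//; lra.
    move=> y By; apply/ltW; rewrite ltNge; apply/negP => Gy.
    by apply: nG; exists y.
  rewrite -JE /cara_measure /= -fine_ball_massE// -/m -EFinM lee_fin.
  by rewrite divfK ?gt_eqF//; lra.
exists (u y) => t t0.
set A := [set x | _].
have mA : nu.-caratheodory A.
  have mu_y : measurable_fun [set: caratheodory_type nu]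
      ((fun x => `|u x - u y|) : caratheodory_type nu -> R).
    by apply: measurableT_comp => //; exact: measurable_funB.
  have -> : A = ball z r `&` ([set: Z] `&`
      (fun x => `|u x - u y|) @^-1` [set` `]t, +oo[]).
    by rewrite /A setTI; apply/seteqP; split=> x /=; rewrite in_itv /= andbT.
  apply: caratheodory_measurable_setI; first exact: caratheodory_ball.
  exact: mu_y measurableT _ (measurable_itv _).
(* A lower bound of the Besov integrand on [A]: distances to [y] are below [2 * r], and the ball in
   the denominator lies in the one about [z] of radius [2 * (2 * r)], of mass at most
   [C ^+ 2 * m]. *)
pose a := t `^ p / (2 * r) `^ (p * theta) / (C ^+ 2 * m).
have a0 : 0 < a.
  by rewrite !divr_gt0 ?mulr_gt0 ?powR_gt0 ?exprn_gt0// mulr_gt0.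
have : (a%:E * cara_measure nu A <= G y)%E.
  apply: integral_minorant => //; first exact: ltW.
    by move=> x; rewrite lee_fin.
  move=> x [Bx tx]; rewrite lee_fin /a /f.
  have xy : x != y.
    by apply: contraTneq tx => ->; rewrite subrr normr0 -leNgt ltW.
  have d0 : 0 < mdist x y by rewrite mdist_gt0.
  have d2r : mdist x y < 2 * r.
    move: Bx By; rewrite !metric_ballE => zx zy.
    by have := metric_triangle x z y; rewrite (metric_sym x z); lra.
  have M0 := ball_mass_gt0 x _ d0.
  have MC : fine (nu (ball x (mdist x y))) <= C ^+ 2 * m.
    apply: (@le_trans _ _ (fine (nu (ball z (2 * (2 * r)))))).
      rewrite fine_le ?ball_mass_fin_num ?mulr_gt0// le_outer_measure//.
      by apply: metric_ball_subset; move: Bx; rewrite metric_ballE; lra.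
    apply: le_trans (dbl _ _ _) _; first by rewrite mulr_gt0.
    by rewrite expr2 -mulrA ler_pM2l// dbl.
  apply: ler_pM; rewrite ?divr_ge0 ?invr_ge0 ?powR_ge0//.
  - by rewrite mulr_ge0 ?exprn_ge0// ltW.
  - apply: ler_pM; rewrite ?invr_ge0 ?powR_ge0//.
      by apply: ge0_ler_powR; rewrite ?nnegrE// ltW.
    rewrite lef_pV2 ?posrE ?powR_gt0 ?mulr_gt0//.
    apply: ge0_ler_powR; rewrite ?nnegrE//; try exact: ltW.
    - by rewrite mulr_ge0// ltW.
    - by rewrite mulr_ge0// ltW.
  - by rewrite lef_pV2 ?posrE// mulr_gt0// exprn_gt0.
move=> /le_trans /(_ Gy).
rewrite -lee_pdivlMl// => /le_trans; apply.
rewrite -EFinM lee_fin /a powRM ?ler0n ?(ltW r0)//.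
have : 0 < t `^ p by rewrite powR_gt0.
have : 0 < 2 `^ (p * theta) :> R by rewrite powR_gt0.
have : 0 < r `^ (p * theta) by rewrite powR_gt0.
move: (t `^ p) (2 `^ (p * theta)) (r `^ (p * theta)) => a1 a2 a3 h1 h2 h3.
by rewrite le_eqVlt; apply/orP; left; apply/eqP; field; rewrite !gt_eqF.
Qed.

End weak_type.

(** * Real powers *)

Lemma powR_inv {R : realType} (a x : R) : 0 <= a -> a^-1 `^ x = (a `^ x)^-1.
Proof. by move=> a0; rewrite -(powR_inv1 a0) powRAC powR_inv1 ?powR_ge0. Qed.

Lemma powR_small {R : realType} (s A e : R) : 0 < s -> 0 < A -> 0 < e ->
  exists2 d : R, 0 < d & forall r, 0 <= r -> r <= d -> A * r `^ s <= e.
Proof.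
move=> s0 A0 e0; exists ((e / A) `^ s^-1); first by rewrite powR_gt0 ?divr_gt0.
move=> r r0 rd; rewrite mulrC -ler_pdivlMr//.
have -> : e / A = ((e / A) `^ s^-1) `^ s.
  by rewrite -powRrM mulVf ?gt_eqF// powRr1 ?divr_ge0 ?ltW.
by rewrite ge0_ler_powR ?nnegrE ?powR_ge0// ltW.
Qed.

(** * Separated nets and coverings *)

Section separated.
Context {R : realType} {Z : completeMetricType R}.
Variable nu : {outer_measure set Z -> \bar R}.
Hypothesis nuP : metric_measure_space nu.

(** Balls of radius [r] about [2 * r]-separated centres are disjoint, so Caratheodory's criterion
    for the first ball detaches its mass from that of the others. *)
Lemma separated_mass (r m : R) (X : set Z) (s : seq Z) :
  (forall x, X x -> (m%:E <= nu (ball x r))%E) ->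
  (forall x, x \in s -> X x) -> pairwise (fun x y => 2 * r <= mdist x y) s ->
  (((size s)%:R * m)%:E <= nu (\bigcup_(x in [set` s]) ball x r))%E.
Proof.
move=> mX; elim: s => [|x s IH] sX /=; first by rewrite mul0r outer_measure_ge0.
move=> /andP[/allP xs ss].
have {}IH := IH (fun y ys => sX y (mem_behead (s := x :: s) ys)) ss.
rewrite (caratheodory_ball nu nuP x r).
rewrite -natr1 mulrDl mul1r EFinD addeC; apply: leeD.
  apply: le_trans (mX x (sX x _)) _; first by rewrite inE eqxx.
  apply: le_outer_measure => y xy; split=> //.
  by exists x => //=; rewrite inE eqxx.
apply: le_trans IH _; apply: le_outer_measure => y [z zs zy]; split.
  by exists z => //=; rewrite inE zs orbT.
move=> xy; have := xs z zs; rewrite metric_ballE in xy.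
rewrite /= metric_ballE in zy.
by have := metric_triangle x y z; rewrite (metric_sym y z); lra.
Qed.

(** Disjointness bounds the size of a separated list by [M / m], so one of maximal size exists;
    maximality makes it a net. *)
Lemma separated_net (r m M : R) (X : set Z) :
  0 < m -> (forall x, X x -> (m%:E <= nu (ball x r))%E) ->
  (nu (\bigcup_(x in X) ball x r) <= M%:E)%E ->
  exists s : seq Z, [/\ (size s)%:R * m <= M, forall x, x \in s -> X x &
    forall x, X x -> exists2 z, z \in s & mdist x z < 2 * r].
Proof.
move=> m0 mX XM.
pose P (s : seq Z) := (forall x, x \in s -> X x) /\
  pairwise (fun x y => 2 * r <= mdist x y) s.
have Psize s : P s -> (size s)%:R * m <= M.
  move=> [sX ss]; rewrite -lee_fin.
  apply: le_trans (separated_mass _ _ _ _ mX sX ss) _; apply: le_trans XM.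
  by apply: le_outer_measure => y [z zs zy]; exists z => //; exact: sX.
pose Pn n := `[< exists2 s, P s & size s = n >].
have ex : exists n, Pn n by exists 0%N; apply/asboolP; exists [::].
have bd n : Pn n -> (n <= Num.truncn (M / m))%N.
  move=> /asboolP[s Ps <-]; rewrite truncn_ge_nat; last first.
    by rewrite divr_ge0 ?(le_trans _ (Psize _ Ps)) ?mulr_ge0// ltW.
  by rewrite ler_pdivlMr// Psize.
case: (ex_maxnP ex bd) => _ /asboolP[s Ps <-] smax.
exists s; split; [exact: Psize|exact: Ps.1|move=> x Xx].
apply: contrapT => nz.
(* A point at distance at least [2 * r] from all of [s] could be added to it. *)
have /smax : Pn (size (x :: s)); last by rewrite /= ltnn.
apply/asboolP; exists (x :: s) => //; split.
  by move=> y; rewrite inE => /predU1P[->//|]; exact: Ps.1.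
rewrite /= Ps.2 andbT; apply/allP => z zs; rewrite leNgt; apply/negP => xz.
by apply: nz; exists z.
Qed.

Lemma outer_measure_bigcup_seq (F : Z -> set Z) (b : R) (s : seq Z) :
  (forall x, x \in s -> (nu (F x) <= b%:E)%E) ->
  (nu (\bigcup_(x in [set` s]) F x) <= ((size s)%:R * b)%:E)%E.
Proof.
elim: s => [|x s IH] Fb.
  by rewrite set_nil bigcup_set0 outer_measure0 mul0r.
have {}IH := IH (fun y ys => Fb y (mem_behead (s := x :: s) ys)).
rewrite /= -natr1 mulrDl mul1r EFinD addeC.
apply: (@le_trans _ _ (nu (F x `|` \bigcup_(y in [set` s]) F y))).
  apply: le_outer_measure => y [z] /=.
  by rewrite inE => /predU1P[->|zs]; [left|right; exists z].
apply: le_trans (outer_measureU2 _ _ _) (leeD _ IH).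
by apply: Fb; rewrite inE eqxx.
Qed.

End separated.

(** * Comparison and convergence of the ball constants *)

Section holder_representative.
Context {R : realType} {Z : completeMetricType R}.
Variable nu : {outer_measure set Z -> \bar R}.
Hypothesis nuP : metric_measure_space nu.
Variables (p q Q K : R) (u : Z -> R) (c : Z -> R -> R).
Hypotheses (p0 : 0 < p) (Q0 : 0 < Q) (Qq : Q < q) (K0 : 0 < K).
Hypothesis decay : relative_lower_volume_decay nu Q.
Hypothesis weak : forall z r t, 0 < r -> 0 < t ->
  (nu [set x | ball z r x /\ (t < `|u x - c z r|)%R]
     <= (K * r `^ q / t `^ p)%:E)%E.

(** For [t] of order r^s the exceptional mass K r^q / t^p is of order r^Q, like the lower bound for
    the mass of a ball. *)
Let s : R := (q - Q) / p.

Let s0 : 0 < s. Proof. by rewrite divr_gt0// subr_gt0. Qed.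

(** The ball about [z] of radius [2 * R0] contains [ball z0 R0]; volume decay from that radius down
    to [r] makes the bound uniform in [z]. *)
Lemma ball_mass_lower (z0 : Z) (R0 : R) : 0 < R0 ->
  exists2 k : R, 0 < k & forall z r, ball z0 R0 z -> 0 < r -> r <= R0 ->
    k * r `^ Q <= fine (nu (ball z r)).
Proof.
move=> R00; have [C C1 dec] := decay.
have C0 : 0 < C by rewrite (lt_le_trans ltr01).
have R20 : 0 < 2 * R0 by rewrite mulr_gt0.
have m0 := ball_mass_gt0 nu nuP z0 R0 R00.
exists (C^-1 / (2 * R0) `^ Q * fine (nu (ball z0 R0))) => [|z r zB r0 rR].
  by rewrite !mulr_gt0 ?invr_gt0 ?powR_gt0.
have M0 := ball_mass_gt0 nu nuP z (2 * R0) R20.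
have := dec z (2 * R0) r r0 _; rewrite ler_pdivlMr// => /(_ _).
have h : r <= 2 * R0 by lra.
move=> /(_ h); apply: le_trans.
have -> : (r / (2 * R0)) `^ Q = r `^ Q / (2 * R0) `^ Q.
  by rewrite (powRM Q (ltW r0)) ?invr_ge0 ?(ltW R20)// powR_inv ?(ltW R20).
have -> a b e f : a / b * e * f = a * (f / b) * e :> R by ring.
apply: ler_wpM2l; first by rewrite !mulr_ge0 ?invr_ge0 ?powR_ge0// ltW.
apply: fine_le; rewrite ?ball_mass_fin_num//; apply: le_outer_measure.
by apply: metric_ball_subset; move: zB; rewrite metric_ballE metric_sym; lra.
Qed.

(** If the constants were more than [2 * t] apart, every point of [ball x rho] would be exceptional
    for one of them, against the mass bound. *)
Lemma weak_value_close (x z z' : Z) (rho r r' t : R) :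
  0 < rho -> 0 < r -> 0 < r' -> 0 < t ->
  ball x rho `<=` ball z r -> ball x rho `<=` ball z' r' ->
  K * r `^ q / t `^ p + K * r' `^ q / t `^ p < fine (nu (ball x rho)) ->
  `|c z r - c z' r'| <= 2 * t.
Proof.
move=> rho0 r0 r'0 t0 xz xz' lt_mass; rewrite leNgt; apply/negP => far.
move: lt_mass; rewrite ltNge => /negP; apply.
rewrite -lee_fin (fine_ball_massE nu nuP)// EFinD.
apply: le_trans (leeD (weak z r t r0 t0) (weak z' r' t r'0 t0)).
apply: le_trans (outer_measureU2 _ _ _); apply: le_outer_measure => y xy.
have [tz|tz] := ltP t `|u y - c z r|; [left; split => //; exact: xz|right].
split; [exact: xz'|]; rewrite ltNge; apply/negP => tz'.
move: far; rewrite ltNge => /negP; apply.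
have -> : c z r - c z' r' = (u y - c z' r') - (u y - c z r) by ring.
by apply: le_trans (ler_normB _ _) _; lra.
Qed.

Lemma weak_value_compare (z0 : Z) (R0 : R) : 0 < R0 ->
  exists2 A : R, 0 < A & forall z z' r r',
    ball z0 R0 z' -> 0 < r -> r <= R0 -> r' <= r -> r <= 2 * r' ->
    mdist z z' + r' <= r -> `|c z r - c z' r'| <= A * r `^ s.
Proof.
move=> R00; have [k k0 mass] := ball_mass_lower z0 R0 R00.
(* With t^p = D r^(q - Q) the two exceptional masses add up to at most 2 K r^Q / D. As
   [r <= 2 * r'], this is less than [k] r'^Q; the summand 1 makes it strict. *)
pose D := 2 * K * 2 `^ Q / k + 1.
have D0 : 0 < D.
  by rewrite addr_gt0// divr_gt0// !mulr_gt0// powR_gt0.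
pose B := D `^ p^-1; have B0 : 0 < B by rewrite powR_gt0.
have BD : B `^ p = D by rewrite -powRrM mulVf ?gt_eqF// powRr1// ltW.
exists (2 * B) => [|z z' r r' z'B r0 rR r'r rr' sub]; first by rewrite mulr_gt0.
have r'0 : 0 < r' by lra.
rewrite -mulrA; apply: (@weak_value_close z' _ _ r') => //.
- by rewrite mulr_gt0 ?powR_gt0.
- exact: metric_ball_subset.
apply: lt_le_trans (mass z' r' z'B r'0 (le_trans r'r rR)).
have rQ : r `^ Q <= 2 `^ Q * r' `^ Q.
  rewrite -powRM ?ler0n ?(ltW r'0)//; apply: ge0_ler_powR => //; first exact: ltW.
    by rewrite nnegrE ltW.
  by rewrite nnegrE mulr_ge0// ltW.
have rq : r' `^ q <= r `^ q.
  have q0 := ltW (lt_trans Q0 Qq).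
  by apply: ge0_ler_powR; rewrite ?nnegrE ?(ltW r0) ?(ltW r'0).
have -> : (B * r `^ s) `^ p = D * (r `^ q / r `^ Q).
  rewrite powRM ?powR_ge0// BD -powRrM /s divfK ?gt_eqF//.
  by rewrite powRB// gt_eqF// implybT.
have q0 : 0 < r `^ q by rewrite powR_gt0.
have rQ0 : 0 < r `^ Q by rewrite powR_gt0.
have r'Q0 : 0 < r' `^ Q by rewrite powR_gt0.
rewrite -mulrDl -mulrDr.
apply: (@le_lt_trans _ _ (K * (2 * r `^ q) / (D * (r `^ q / r `^ Q)))).
  by rewrite ler_pM2r ?ler_pM2l ?invr_gt0 ?mulr_gt0 ?invr_gt0//; lra.
have -> : K * (2 * r `^ q) / (D * (r `^ q / r `^ Q)) = 2 * K * r `^ Q / D.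
  by field; rewrite !gt_eqF.
rewrite ltr_pdivrMr//; apply: (@le_lt_trans _ _ (2 * K * (2 `^ Q * r' `^ Q))).
  by rewrite ler_pM2l ?mulr_gt0.
have -> : k * r' `^ Q * D = 2 * K * (2 `^ Q * r' `^ Q) + k * r' `^ Q.
  by rewrite /D; field; rewrite gt_eqF.
by rewrite ltrDl mulr_gt0.
Qed.

(** Halving the radius repeatedly gives differences dominated by a geometric series of ratio 2^(-s)
    < 1. *)
Lemma weak_value_cauchy (z0 : Z) (R0 : R) : 0 < R0 ->
  exists2 A : R, 0 < A & forall z r r', ball z0 R0 z ->
    0 < r' -> r' <= r -> r <= R0 -> `|c z r - c z r'| <= A * r `^ s.
Proof.
move=> R00; have [A A0 cmp] := weak_value_compare z0 R0 R00.
have h1 : 2 `^ (- s) < 1 :> R.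
  rewrite powRN invf_lt1 ?powR_gt0//.
  rewrite -[ltLHS](_ : 1 `^ s = 1); last by rewrite powR1.
  by apply: gt0_ltr_powR; rewrite ?nnegrE ?ler0n ?ler01// ltr1n.
pose h : R := 2 `^ (- s).
have hE (r : R) : 0 < r -> (r / 2) `^ s = h * r `^ s.
  move=> r0; rewrite powRM ?invr_ge0 ?ler0n ?(ltW r0)// mulrC.
  by rewrite /h powRN powR_inv ?ler0n.
exists (A / (1 - h)) => [|z r r' zB r'0 r'r rR].
  by rewrite divr_gt0// subr_gt0.
have [n rn] : exists n, r <= r' * 2 ^+ n.
  exists (Num.truncn (r / r')).+1; rewrite mulrC -ler_pdivrMr//.
  apply/ltW/(lt_le_trans (truncnS_gt _)).
  by rewrite -natrX ler_nat ltnW// ltn_expl.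
(* The sum of the geometric series equals its first term plus [h] times itself; this absorbs one
   halving in the induction. *)
have AE x : A / (1 - h) * x = A * x + A / (1 - h) * (h * x).
  by field; rewrite gt_eqF// subr_gt0.
have A'x x : 0 <= x -> A * x <= A / (1 - h) * x.
  by move=> x0; rewrite AE lerDl !mulr_ge0 ?invr_ge0 ?powR_ge0// ltW// subr_gt0.
elim: n r r'r rR rn => [|n IH] r r'r rR rn.
  have -> : r = r' by apply/le_anti; rewrite r'r andbT -[r']mulr1.
  by rewrite subrr normr0 !mulr_ge0 ?invr_ge0 ?powR_ge0 ?subr_ge0// ltW.
have r0 : 0 < r by apply: lt_le_trans r'r.
have [big|small] := leP r (2 * r').
  apply: le_trans (A'x _ (powR_ge0 _ _)).
  by apply: cmp => //; rewrite mdistxx add0r.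
have -> : c z r - c z r' = (c z r - c z (r / 2)) + (c z (r / 2) - c z r') by ring.
apply: le_trans (ler_normD _ _) _; rewrite AE -hE//; apply: lerD.
  by apply: cmp => //; rewrite ?mdistxx; lra.
apply: IH; [lra|lra|].
by rewrite exprS in rn; lra.
Qed.

(** By the Cauchy estimate every c(z, r') - A r'^s lies below every c(z, r) + A r^s, for radii up to
    1; the supremum of the former is the limit. *)
Lemma weak_value_cvg (z : Z) : exists v : R, forall e, 0 < e ->
  exists2 d : R, 0 < d & forall r, 0 < r -> r <= d -> `|c z r - v| <= e.
Proof.
have [A A0 cau] := weak_value_cauchy z 1 ltr01.
have zz : ball z 1 z by rewrite metric_ballE mdistxx.
pose S := [set x | exists2 r, 0 < r <= 1 & x = c z r - A * r `^ s].
have ub r x : 0 < r <= 1 -> S x -> x <= c z r + A * r `^ s.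
  move=> /andP[r0 r1] [r' /andP[r'0 r'1] ->].
  have ge0 (y : R) : 0 <= A * y `^ s by rewrite mulr_ge0 ?powR_ge0// ltW.
  have := ge0 r; have := ge0 r'.
  have [rr'|r'r] := leP r r'.
    by have := cau z r' r zz r0 rr' r'1; rewrite ler_norml => /andP[]; lra.
  by have := cau z r r' zz r'0 (ltW r'r) r1; rewrite ler_norml => /andP[]; lra.
have S1 : S (c z 1 - A * 1 `^ s) by exists 1 => //; rewrite ltr01 lexx.
have hS : has_sup S.
  split; first by exists (c z 1 - A * 1 `^ s).
  by exists (c z 1 + A * 1 `^ s) => x Sx; apply: ub => //; rewrite ltr01 lexx.
exists (sup S) => e e0; have [d d0 hd] := powR_small s A e s0 A0 e0.
exists (Num.min d 1) => [|r r0]; first by rewrite lt_min d0 ltr01.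
rewrite le_min => /andP[rd r1].
have r01 : 0 < r <= 1 by rewrite r0 r1.
have le1 : c z r - A * r `^ s <= sup S by apply: sup_upper_bound => //; exists r.
have le2 : sup S <= c z r + A * r `^ s.
  by apply: ge_sup => [|x]; [exists (c z 1 - A * 1 `^ s)|exact: ub].
by rewrite ler_norml; have := hd r (ltW r0) rd; lra.
Qed.

(** * Hölder continuity of the limit and its agreement with [u] *)

Variable v : Z -> R.
Hypothesis cv : forall z e, 0 < e ->
  exists2 d : R, 0 < d & forall r, 0 < r -> r <= d -> `|c z r - v z| <= e.

(** The Cauchy estimate passes to the limit in its smaller radius. *)
Lemma weak_value_rate (z0 : Z) (R0 : R) : 0 < R0 ->
  exists2 A : R, 0 < A & forall z r, ball z0 R0 z ->
    0 < r -> r <= R0 -> `|c z r - v z| <= A * r `^ s.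
Proof.
move=> R00; have [A A0 cau] := weak_value_cauchy z0 R0 R00.
exists A => // z r zB r0 rR; apply/ler_addgt0Pr => e e0.
have [d d0 hd] := cv z e e0.
have m0 : 0 < Num.min d r by rewrite lt_min d0.
have -> : c z r - v z =
  (c z r - c z (Num.min d r)) + (c z (Num.min d r) - v z) by ring.
apply: le_trans (ler_normD _ _) _; apply: lerD.
  by apply: cau => //; rewrite ge_min lexx orbT.
by apply: hd => //; rewrite ge_min lexx.
Qed.

(** With d the distance of x and y, B(y, d) lies in B(x, 2d); the chain v x, c(x, 2d), c(y, d), v y
    has links of order d^s. *)
Lemma limit_locally_holder (a : R) : 0 < a -> a <= s -> locally_holder a v.
Proof.
move=> a0 as_ z0 r0 r00.
(* Two points of the ball have distance below [2 * r0], so the radius [2 * d] stays below [R0]. *)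
pose R0 := 4 * r0; have R00 : 0 < R0 by rewrite mulr_gt0.
have [A A0 cmp] := weak_value_compare z0 R0 R00.
have [B B0 rate] := weak_value_rate z0 R0 R00.
(* [A] compares the two constants, [2 * B] pays for two limits, 2^s for the radius [2 * d]; the last
   factor lowers the exponent from [s] to [a]. *)
exists ((A + 2 * B) * 2 `^ s * (2 * r0) `^ (s - a)) => x y xB yB.
have [->|xy] := eqVneq x y.
  by rewrite subrr normr0 !mulr_ge0 ?powR_ge0//; lra.
have d0 : 0 < mdist x y by rewrite mdist_gt0.
set d := mdist x y in d0 *.
have dr : d < 2 * r0.
  move: xB yB; rewrite !metric_ballE => xB yB.
  by have := metric_triangle x z0 y; rewrite (metric_sym x z0) -/d; lra.
have sub w : ball z0 r0 w -> ball z0 R0 w.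
  by rewrite !metric_ballE /R0; lra.
have h1 : `|c x (2 * d) - v x| <= B * (2 * d) `^ s.
  by apply: rate; [exact: sub|rewrite mulr_gt0|rewrite /R0; lra].
have h2 : `|c y d - v y| <= B * (2 * d) `^ s.
  apply: le_trans (rate y d (sub _ yB) d0 _) _; first by rewrite /R0; lra.
  rewrite ler_pM2l//; apply: ge0_ler_powR; rewrite ?nnegrE; try exact: ltW.
  - by rewrite mulr_ge0// ltW.
  - by lra.
have h3 : `|c x (2 * d) - c y d| <= A * (2 * d) `^ s.
  by apply: cmp; rewrite ?mulr_gt0//; [exact: sub|rewrite /R0| |rewrite -/d]; lra.
have h4 : d `^ s <= (2 * r0) `^ (s - a) * d `^ a.
  rewrite -[in leLHS](subrK a s) (@powRD _ d); last by rewrite (gt_eqF d0) implybT.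
  rewrite ler_pM2r ?powR_gt0//; apply: ge0_ler_powR; rewrite ?nnegrE ?subr_ge0//.
  - exact: ltW.
  - by rewrite mulr_ge0// ltW.
  - exact: ltW.
have -> : v x - v y = (c x (2 * d) - c y d) - (c x (2 * d) - v x) + (c y d - v y).
  by ring.
apply: (@le_trans _ _ ((A + 2 * B) * (2 * d) `^ s)).
  apply: le_trans (ler_normD _ _) _; apply: le_trans (lerD (ler_normB _ _) (lexx _)) _.
  by lra.
rewrite (@powRM _ 2 d s)// ?(ltW d0)// -!mulrA.
by rewrite !ler_pM2l ?powR_gt0//; lra.
Qed.

Lemma limit_far_null (z0 : Z) (R0 e : R) : 0 < R0 -> 0 < e ->
  nu [set x | ball z0 R0 x /\ e < `|u x - v x|] = 0%E.
Proof.
move=> R00 e0.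
have [k k0 mass] := ball_mass_lower z0 R0 R00.
have [A A0 cmp] := weak_value_compare z0 R0 R00.
have [B B0 rate] := weak_value_rate z0 R0 R00.
have e2 : 0 < e / 2 by rewrite divr_gt0.
have R20 : 0 < 2 * R0 by rewrite mulr_gt0.
have qQ : 0 < q - Q by rewrite subr_gt0.
pose M := fine (nu (ball z0 (2 * R0))).
have M0 : 0 < M by exact: ball_mass_gt0.
(* At most M / (k r^Q) balls, each with exceptional mass at most K (4r)^q / (e/2)^p, give C r^(q -
   Q). *)
pose C := M * K * 4 `^ q / (k * (e / 2) `^ p).
have C0 : 0 < C by rewrite !(mulr_gt0, invr_gt0, powR_gt0).
apply/le_anti/andP; split; last exact: outer_measure_ge0.
apply/lee_addgt0Pr => h h0; rewrite add0e.
have [d1 d10 hd1] := powR_small s (A + B) (e / 2) s0 (addr_gt0 A0 B0) e2.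
have [d2 d20 hd2] := powR_small (q - Q) C h qQ C0 h0.
(* [d1] keeps the constants within [e / 2] of [v], [R0] keeps the local estimates valid, [d2] makes
   the total mass at most [h]. *)
pose r := Num.min (Num.min d1 R0) d2 / 4.
have r4 : 4 * r = Num.min (Num.min d1 R0) d2 by rewrite /r; field.
have r0 : 0 < r by rewrite divr_gt0// !lt_min d10 R00.
have rd1 : 4 * r <= d1 by rewrite r4 !ge_min lexx.
have rR : 4 * r <= R0 by rewrite r4 !ge_min lexx orbT.
have rd2 : 4 * r <= d2 by rewrite r4 ge_min lexx orbT.
have m0 : 0 < k * r `^ Q by rewrite mulr_gt0 ?powR_gt0.
have [||l [lM lB lcov]] :=
    @separated_net _ _ nu nuP r (k * r `^ Q) M (ball z0 R0) m0.
- move=> x xB; rewrite -(fine_ball_massE nu nuP)// lee_fin.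
  by apply: mass => //; lra.
- rewrite (fine_ball_massE nu nuP)//; apply: le_outer_measure.
  move=> y [x xB xy]; apply: (metric_ball_subset z0 x (2 * R0) r) => //.
  by move: xB; rewrite metric_ballE; lra.
pose F z := [set x | ball z (4 * r) x /\ e / 2 < `|u x - c z (4 * r)|].
have r40 : 0 < 4 * r by rewrite mulr_gt0.
have Fle z : z \in l -> (nu (F z) <= (K * (4 * r) `^ q / (e / 2) `^ p)%:E)%E.
  by move=> _; exact: weak.
(* A point [x] within [2 * r] of the centre [z] has [v x] within [e / 2] of [c z (4 * r)], through
   [c x (2 * r)]; if [u x] is far from [v x], then [x] is exceptional for [z]. *)
apply: (@le_trans _ _ (nu (\bigcup_(z in [set` l]) F z))).
  apply: le_outer_measure => x [xB far]; have [z zl xz] := lcov x xB.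
  exists z => //; split; first by rewrite metric_ballE metric_sym; lra.
  rewrite ltNge; apply/negP => near; move: far; rewrite ltNge => /negP; apply.
  have h1 : `|c z (4 * r) - c x (2 * r)| <= A * (4 * r) `^ s.
    by apply: cmp => //; rewrite ?(metric_sym z x); lra.
  have h2 : `|c x (2 * r) - v x| <= B * (4 * r) `^ s.
    apply: le_trans (rate x (2 * r) xB _ _) _; [lra|lra|].
    rewrite ler_pM2l//; apply: ge0_ler_powR; rewrite ?nnegrE; try exact: ltW.
    - by lra.
    - by lra.
  have h3 := hd1 (4 * r) (ltW r40) rd1.
  have -> : u x - v x = (u x - c z (4 * r)) + (c z (4 * r) - c x (2 * r))
    + (c x (2 * r) - v x) by ring.
  apply: le_trans (ler_normD _ _) _.
  apply: le_trans (lerD (ler_normD _ _) (lexx _)) _.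
  by lra.
apply: le_trans (outer_measure_bigcup_seq _ _ _ _ Fle) _.
rewrite lee_fin.
apply: le_trans (hd2 r (ltW r0) _); last by lra.
have -> : C * r `^ (q - Q) = M / (k * r `^ Q) * (K * (4 * r) `^ q / (e / 2) `^ p).
  rewrite /C powRB ?(gt_eqF r0) ?implybT// (@powRM _ 4 r q)// ?(ltW r0)//.
  by field; rewrite !gt_eqF// powR_gt0.
apply: ler_wpM2r; last by rewrite ler_pdivlMr.
by rewrite divr_ge0 ?mulr_ge0 ?powR_ge0// ltW.
Qed.

Lemma limit_representative : representative nu u v.
Proof.
pose E n := [set x | ball (point : Z) n.+1%:R x /\ n.+1%:R^-1 < `|u x - v x|].
have E0 : nu (\bigcup_n E n) = 0%E.
  apply/le_anti/andP; split; last exact: outer_measure_ge0.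
  apply: le_trans (outer_measure_sigma_subadditive nu E) _.
  by rewrite eseries0// => n _ _; apply: limit_far_null; rewrite ?invr_gt0.
exists (\bigcup_n E n); split=> //.
  (* A set of outer measure zero is Caratheodory measurable. *)
  apply: le_caratheodory_measurable => X.
  rewrite -[leRHS]add0e; apply: leeD; last exact: le_outer_measure.
  by rewrite -E0; apply: le_outer_measure => x [].
move=> x /= /eqP uv.
have d0 : 0 < `|u x - v x| by rewrite normr_gt0 subr_eq0.
(* [n.+1] exceeds both the distance to [point] and the inverse of the gap, so [x] lies in [E n]. *)
pose n := Num.truncn (Num.max (mdist point x) (`|u x - v x|^-1)).
exists n => //; have := truncnS_gt (Num.max (mdist point x) (`|u x - v x|^-1)).
rewrite -/n gt_max => /andP[xn un]; split; first by rewrite metric_ballE.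
by rewrite -[ltRHS]invrK ltf_pV2 ?posrE ?invr_gt0.
Qed.

End holder_representative.

(** * Choice of the ball constants and comparison of exponents *)

Theorem corollary1p3 (R : realType) (Z : completeMetricType R)
    (nu : {outer_measure set Z -> \bar R}) (p theta Q Qbeta : R) :
  metric_measure_space nu -> doubling nu ->
  1 <= p -> 0 < theta -> theta < 1 ->
  0 < Q -> relative_lower_volume_decay nu Q ->
  Qbeta = Num.max 1 (Q + p * (1 - theta)) ->
  Qbeta < p ->
  forall u : Z -> R, besov_space nu theta p u ->
    exists2 v : Z -> R, representative nu u v &
      locally_holder (1 - Qbeta / p) v.
Proof.
move=> nuP dbl p1 th0 _ Q0 decay QbetaE Qp u bes.
have p0 : 0 < p by lra.
have Qbeta_ge : Q + p * (1 - theta) <= Qbeta.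
  by rewrite QbetaE le_max lexx orbT.
have Qq : Q < p * theta by lra.
have [K K0 weak] := besov_weak_type nu nuP p theta u dbl p1 th0 bes.
(* One constant is fixed per ball before [t] varies; nonpositive radii get the dummy value 0. *)
have /choice[c cP] : forall zr : Z * R, exists c : R, 0 < zr.2 -> forall t, 0 < t ->
    (nu [set x | ball zr.1 zr.2 x /\ (t < `|u x - c|)%R]
       <= (K * zr.2 `^ (p * theta) / t `^ p)%:E)%E.
  move=> [z r]; have [r0|r0] := ltP 0 r; last first.
    by exists 0 => /= r_gt0; lra.
  by have [c cP] := weak z r r0; exists c => _; exact: cP.
have {}weak z r t (r0 : 0 < r) (t0 : 0 < t) := cP (z, r) r0 t t0.
have /choice[v vP] := weak_value_cvg nu nuP p (p * theta) Q K u
  (fun z r => c (z, r)) p0 Q0 Qq K0 decay weak.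
exists v.
  exact: (limit_representative nu nuP p (p * theta) Q K u
    (fun z r => c (z, r)) p0 Q0 Qq K0 decay weak v vP).
apply: (limit_locally_holder nu nuP p (p * theta) Q K u
  (fun z r => c (z, r)) p0 Q0 Qq K0 decay weak v vP).
  by rewrite subr_gt0 ltr_pdivrMr ?mul1r.
(* Multiplied by [p], the comparison with [s] reads [p - Qbeta <= p * theta - Q], which is
   [Qbeta_ge]. *)
rewrite ler_pdivlMr// mulrBl divfK ?gt_eqF//; lra.
Qed.
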